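(* Let $n\ge 1$ and let $X=(X_{ijk})_{1\le i,j,k\le n}$ be an $n\times n\times n$ array of independent commuting variables. Then $L^{se}_{n^3}-L^{so}_{n^3}$ equals the coefficient of the monomial $\prod_{i=1}^n\prod_{j=1}^n\prod_{k=1}^n X_{ijk}$ in $\mathrm{Det}(X)^{n^2}$.
   Context: A Latin cube of order $n$ is an $n\times n\times n$ array $L=(L_{ijk})$ with entries in $[n^2]$ such that each symbol of $[n^2]$ occurs exactly once in each $i$-slice (fixed $i$), each $j$-slice and each $k$-slice. For each symbol $s$ the positions $(i,j,k)$ with $L_{ijk}=s$ form a set $\{(i,\sigma_s(i),\tau_s(i))\mid i\in[n]\}$ for unique $\sigma_s,\tau_s\in S_n$. The symbol sign of $L$ is $\mathrm{sym}(L)=\prod_{s=1}^{n^2}\mathrm{sgn}(\sigma_s)\,\mathrm{sgn}(\tau_s)$; $L$ is symbol-even if $\mathrm{sym}(L)=+1$ and symbol-odd if $\mathrm{sym}(L)=-1$. $L^{se}_{n^3}$ and $L^{so}_{n^3}$ denote the numbers of symbol-even and symbol-odd Latin cubes of order $n$. The hyperdeterminant is $\mathrm{Det}(X)=\sum_{\sigma\in S_n}\sum_{\tau\in S_n}\mathrm{sgn}(\sigma)\,\mathrm{sgn}(\tau)\prod_{i=1}^n X_{i,\sigma(i),\tau(i)}$. *)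

(* Defs.v *)
From mathcomp Require Import all_boot all_fingroup all_algebra.
From mathcomp Require Export mpoly.

Set Implicit Arguments.
Unset Strict Implicit.
Unset Printing Implicit Defensive.

Import GRing.Theory.
Local Open Scope ring_scope.

Section Cubes.
Variable n : nat.

Definition position : predArgType := ('I_n * 'I_n * 'I_n)%type.

Definition cube := {ffun position -> 'I_(n ^ 2)}.

Definition is_latin_cube (L : cube) : bool :=
  [forall s : 'I_(n ^ 2),
    [&& [forall i : 'I_n, #|[set p : 'I_n * 'I_n | L (i, p.1, p.2) == s]| == 1%N],
        [forall j : 'I_n, #|[set p : 'I_n * 'I_n | L (p.1, j, p.2) == s]| == 1%N]
      & [forall k : 'I_n, #|[set p : 'I_n * 'I_n | L (p.1, p.2, k) == s]| == 1%N]]].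

Definition symbol_positions (L : cube) (s : 'I_(n ^ 2)) : {set position} :=
  [set x | L x == s].

Definition diagonal (st : 'S_n * 'S_n) : {set position} :=
  [set (i, st.1 i, st.2 i) | i : 'I_n].

(* The pair (sigma_s, tau_s). The default (1, 1) is never used when L is a
   Latin cube: see symbol_perms_unique and symbol_permsP below. *)
Definition symbol_perms (L : cube) (s : 'I_(n ^ 2)) : 'S_n * 'S_n :=
  odflt (1%g, 1%g) [pick st | symbol_positions L s == diagonal st].

Definition symbol_sign (L : cube) : int :=
  \prod_(s < n ^ 2)
    ((-1) ^+ (symbol_perms L s).1 * (-1) ^+ (symbol_perms L s).2).

Definition num_symbol_even : nat :=
  #|[set L : cube | is_latin_cube L & symbol_sign L == 1]|.

Definition num_symbol_odd : nat :=
  #|[set L : cube | is_latin_cube L & symbol_sign L == -1]|.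

Definition hyperdet (R : comNzRingType) (X : 'I_n -> 'I_n -> 'I_n -> R) : R :=
  \sum_(sigma : 'S_n) \sum_(tau : 'S_n)
    (-1) ^+ sigma * (-1) ^+ tau * \prod_(i < n) X i (sigma i) (tau i).

(* The variables X_ijk are the indeterminates of a polynomial ring in #|position|
   variables, numbered by the canonical bijection position -> 'I_#|position|. *)
Definition var (i j k : 'I_n) : 'I_#|{: position}| := enum_rank (i, j, k).

Definition generic_array (i j k : 'I_n) : {mpoly int[#|{: position}|]} :=
  'X_(var i j k).

(* Exponent vectors are written additively, so this is prod_ijk X_ijk: see
   full_monomialE below. *)
Definition full_monomial : 'X_{1..#|{: position}|} :=
  (\sum_(i < n) \sum_(j < n) \sum_(k < n) U_(var i j k))%MM.

Lemma full_monomialE :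
  'X_[full_monomial] = \prod_(i < n) \prod_(j < n) \prod_(k < n) generic_array i j k.
Proof.
rewrite -mprodXE; apply: eq_bigr => i _; rewrite -mprodXE.
by apply: eq_bigr => j _; rewrite -mprodXE.
Qed.

Lemma diagonal_inj : injective diagonal.
Proof.
move=> [s t] [s' t'] /setP eq_d.
have E i : s i = s' i /\ t i = t' i.
  have : (i, s i, t i) \in diagonal (s, t) by apply/imsetP; exists i.
  by rewrite eq_d => /imsetP[j _ /= [-> -> ->]].
by congr (_, _); apply/permP => i; case: (E i).
Qed.

Lemma symbol_perms_ex (L : cube) s : is_latin_cube L ->
  exists st, symbol_positions L s = diagonal st.
Proof.
move=> /forallP/(_ s)/and3P[/forallP Hi /forallP Hj /forallP Hk].
have {}Hi i : exists p : 'I_n * 'I_n, [set p | L (i, p.1, p.2) == s] = [set p].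
  exact/cards1P.
have [f Hf] := fin_all_exists Hi.
have Lf i : L (i, (f i).1, (f i).2) = s.
  by have /setP/(_ (f i)) := Hf i; rewrite !inE eqxx => /eqP.
have s_inj : injective (fun i => (f i).1).
  move=> i i' /= e; have /cards1P[q /setP Hq] := Hj (f i).1.
  have := Hq (i, (f i).2); have := Hq (i', (f i').2).
  rewrite !inE /= Lf {1}e Lf eqxx => /esym/eqP <- /esym/eqP.
  by case.
have t_inj : injective (fun i => (f i).2).
  move=> i i' /= e; have /cards1P[q /setP Hq] := Hk (f i).2.
  have := Hq (i, (f i).1); have := Hq (i', (f i').1).
  rewrite !inE /= Lf {1}e Lf eqxx => /esym/eqP <- /esym/eqP.
  by case.
exists (perm s_inj, perm t_inj); apply/setP => -[[i j] k].
rewrite inE; apply/eqP/imsetP => [Lx | [i' _ [-> -> ->]]].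
  exists i => //=; rewrite !permE.
  have /setP/(_ (j, k)) := Hf i; rewrite !inE /= Lx eqxx.
  by move=> /esym/eqP <-.
by rewrite /= !permE Lf.
Qed.

Lemma symbol_perms_unique (L : cube) s : is_latin_cube L ->
  exists! st, symbol_positions L s = diagonal st.
Proof.
move=> /symbol_perms_ex-/(_ s)[st Hst]; exists st; split=> // st'.
by rewrite Hst => /diagonal_inj.
Qed.

Lemma symbol_permsP (L : cube) s : is_latin_cube L ->
  symbol_positions L s = diagonal (symbol_perms L s).
Proof.
move=> /symbol_perms_ex-/(_ s)[st Hst]; rewrite /symbol_perms.
by case: pickP => [st' /eqP // | /(_ st)]; rewrite Hst eqxx.
Qed.

End Cubes.

(* Main.v *)
Require Import Defs.
From mathcomp Require Import all_boot all_fingroup all_algebra.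
Local Open Scope ring_scope.

(** Each term of the hyperdeterminant is a sign times the product of the
    variables over a diagonal, the graph [{(i, sigma i, tau i)}] of a pair of
    permutations.  Expanding the [n ^ 2]-th power therefore amounts to choosing a
    diagonal for each symbol [s], that is, a family [F] of pairs of permutations
    indexed by the symbols, and the monomial obtained is the multiplicity
    with which the chosen diagonals cover each position
    ([hyperdet_exp_expansion]).  This is the full monomial exactly when every
    position lies on one and only one of the diagonals ([family_monomial_full]).

    Such families are the same thing as Latin cubes.  In a Latin cube the
    positions of each symbol form a diagonal, and these diagonals partition
    the positions.  Conversely, given a partition into labelled diagonals, writing
    each label along its diagonal gives a Latin cube, since a diagonal meets each
    slice in a single position ([latin_of_diagonals]).  The sign of the
    term indexed by [F] is by definition the symbol sign of the cube, so
    the coefficient is the sum of the symbol signs of all Latin cubes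
    ([sum_tiling_latin]), which counts the even cubes minus the odd ones
    ([sum_symbol_sign]). *)

Set Implicit Arguments.
Unset Strict Implicit.
Unset Printing Implicit Defensive.

Import GRing.Theory.

Section LatinCubes.
Variable n : nat.

Local Notation pos := (position n).
Local Notation symbol := 'I_(n ^ 2).
Local Notation perm_pair := ('S_n * 'S_n)%type.
Local Notation family := {ffun symbol -> perm_pair}.

(** * Latin cubes as tilings by diagonals *)

Definition perm_pair_sign (st : perm_pair) : int :=
  (-1) ^+ st.1 * (-1) ^+ st.2.

Lemma in_diagonal (st : perm_pair) (i j k : 'I_n) :
  ((i, j, k) \in diagonal st) = (st.1 i == j) && (st.2 i == k).
Proof.
apply/imsetP/andP => [[i' _ [-> -> ->]] // | [/eqP <- /eqP <-]].
by exists i.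
Qed.

(** The slices in direction [j] and [k] are met at the rows [sigma^-1 j] and
    [tau^-1 k]; this is where bijectivity of the two permutations is used. *)
Lemma latin_of_diagonals (L : cube n) (F : symbol -> perm_pair) :
  (forall s, symbol_positions L s = diagonal (F s)) -> is_latin_cube L.
Proof.
move=> LF; apply/forallP => s.
have Ls i j k : (L (i, j, k) == s) = ((F s).1 i == j) && ((F s).2 i == k).
  by rewrite -in_diagonal -LF inE.
case: (F s) Ls => sigma tau /= Ls.
apply/and3P; split; apply/forallP => a; apply/cards1P.
- exists (sigma a, tau a); apply/setP => -[j k].
  by rewrite !inE Ls /= xpair_eqE (eq_sym j) (eq_sym k).
- exists (sigma^-1 a, tau (sigma^-1 a))%g; apply/setP => -[i k].
  rewrite !inE Ls /= xpair_eqE -[i == _](inj_eq (@perm_inj _ sigma)) permKV.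
  by case: eqP => //= <-; rewrite permK eq_sym.
- exists (tau^-1 a, sigma (tau^-1 a))%g; apply/setP => -[i j].
  rewrite !inE Ls /= xpair_eqE andbC -[i == _](inj_eq (@perm_inj _ tau)) permKV.
  by case: eqP => //= <-; rewrite permK eq_sym.
Qed.

Definition tiling (F : family) : bool :=
  [forall x : pos, #|[set s | x \in diagonal (F s)]| == 1%N].

Definition family_of_cube (L : cube n) : family :=
  [ffun s => symbol_perms L s].

(** Positions that no diagonal of [F] reaches get the default symbol [s0],
    which exists because [n] is positive. *)
Definition cube_of_family (s0 : symbol) (F : family) : cube n :=
  [ffun x => odflt s0 [pick s | x \in diagonal (F s)]].

Lemma symbol_positions_cube_of_family s0 F s :
  tiling F -> symbol_positions (cube_of_family s0 F) s = diagonal (F s).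
Proof.
move=> /forallP Ft; apply/setP => x; rewrite inE ffunE.
have /cards1P[s1 /setP Es1] := Ft x.
have {}Es1 s' : (x \in diagonal (F s')) = (s' == s1).
  by have := Es1 s'; rewrite !inE.
rewrite Es1; case: pickP => [s' | /(_ s1)]; rewrite Es1 ?eqxx //.
by move=> /eqP ->; rewrite eq_sym.
Qed.

Lemma cube_of_familyK s0 F :
  tiling F -> family_of_cube (cube_of_family s0 F) = F.
Proof.
move=> Ft; apply/ffunP => s; rewrite ffunE; apply: diagonal_inj.
have LF s' := symbol_positions_cube_of_family s0 s' Ft.
by rewrite -(symbol_permsP s (latin_of_diagonals LF)) LF.
Qed.

Lemma family_of_latinP (L : cube n) s x : is_latin_cube L ->
  (x \in diagonal (family_of_cube L s)) = (s == L x).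
Proof. by move=> Ll; rewrite ffunE -symbol_permsP // inE eq_sym. Qed.

Lemma family_of_latin_tiling (L : cube n) :
  is_latin_cube L -> tiling (family_of_cube L).
Proof.
move=> Ll; apply/forallP => x; apply/cards1P; exists (L x).
by apply/setP => s; rewrite !inE family_of_latinP.
Qed.

Lemma family_of_latinK s0 (L : cube n) :
  is_latin_cube L -> cube_of_family s0 (family_of_cube L) = L.
Proof.
move=> Ll; apply/ffunP => x; rewrite ffunE.
by case: pickP => [s | /(_ (L x))]; rewrite family_of_latinP ?eqxx // => /eqP.
Qed.

(** This form of the Latin condition is the side condition that reindexing a
    sum over tilings by [family_of_cube] produces.  The round trip
    [cube_of_family s0 (family_of_cube L) = L] is essential: for an arbitrary cube,
    [symbol_perms] returns the identity pair at every symbol whose positions do not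
    form a diagonal, and the resulting family may tile by accident. *)
Lemma is_latin_cube_tiling s0 (L : cube n) :
  is_latin_cube L = tiling (family_of_cube L) &&
                    (cube_of_family s0 (family_of_cube L) == L).
Proof.
apply/idP/andP => [Ll | [Ft /eqP LK]].
  by rewrite family_of_latin_tiling // family_of_latinK.
apply: (@latin_of_diagonals L (family_of_cube L)) => s.
by rewrite -{1}LK symbol_positions_cube_of_family.
Qed.

Lemma sum_tiling_latin (s0 : symbol) :
  \sum_(F : family | tiling F) \prod_s perm_pair_sign (F s) =
  \sum_(L : cube n | is_latin_cube L) symbol_sign L.
Proof.
rewrite (reindex_onto family_of_cube (cube_of_family s0)) => [|F Ft]; last first.
  exact: cube_of_familyK.
apply: eq_big => [L | L _]; first by rewrite -is_latin_cube_tiling.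
by apply: eq_bigr => s _; rewrite ffunE.
Qed.

Lemma symbol_sign_bool (L : cube n) : exists b : bool, symbol_sign L = (-1) ^+ b.
Proof.
rewrite /symbol_sign; elim/big_ind: _ => [|x y [b ->] [c ->]|s _].
- by exists false.
- by exists (b (+) c); rewrite signr_addb.
- by rewrite -signr_addb; eexists.
Qed.

Lemma sum_symbol_sign :
  \sum_(L : cube n | is_latin_cube L) symbol_sign L =
  (num_symbol_even n)%:Z - (num_symbol_odd n)%:Z.
Proof.
have countE e : (#|[set L : cube n | is_latin_cube L & symbol_sign L == e]|)%:Z =
    \sum_(L : cube n | is_latin_cube L) (symbol_sign L == e)%:R.
  rewrite cardsE -sum1_card -natz natr_sum big_mkcondr /=.
  by apply: eq_bigr => L _; case: (_ == e).
rewrite /num_symbol_even /num_symbol_odd !countE -sumrB.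
by apply: eq_bigr => L _; have [[] ->] := symbol_sign_bool L.
Qed.

(** * The expansion of the power of the hyperdeterminant *)

Local Notation multinom := 'X_{1..#|{: pos}|}.

Definition diagonal_monomial (st : perm_pair) : multinom :=
  (\sum_(i < n) U_(var i (st.1 i) (st.2 i)))%MM.

Definition family_monomial (F : family) : multinom :=
  (\sum_(s < n ^ 2) diagonal_monomial (F s))%MM.

Lemma hyperdet_generic :
  hyperdet (@generic_array n) =
  \sum_(st : perm_pair) perm_pair_sign st *: 'X_[diagonal_monomial st].
Proof.
rewrite /hyperdet pair_bigA /=; apply: eq_bigr => -[sigma tau] _ /=.
by rewrite mprodXE /perm_pair_sign /= -!signr_addb scaler_sign mulr_sign.
Qed.

(** Distributivity turns the product over the symbols of sums over pairs of
    permutations into a single sum over families. *)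
Lemma hyperdet_exp_expansion :
  hyperdet (@generic_array n) ^+ (n ^ 2) =
  \sum_(F : family)
    (\prod_s perm_pair_sign (F s)) *: 'X_[family_monomial F].
Proof.
rewrite hyperdet_generic -{1}[(n ^ 2)%N]card_ord -prodr_const.
rewrite bigA_distr_bigA /=; apply: eq_bigr => F _.
by rewrite scaler_prod mprodXE.
Qed.

Lemma diagonal_monomialE st (x : pos) :
  diagonal_monomial st (enum_rank x) = (x \in diagonal st).
Proof.
case: x => [[i j] k]; rewrite mnm_sumE (bigD1 i) //= big1 => [|i' ne_i'].
  by rewrite mnm1E (inj_eq enum_rank_inj) !xpair_eqE eqxx addn0 in_diagonal.
by rewrite mnm1E (inj_eq enum_rank_inj) !xpair_eqE (negPf ne_i').
Qed.

Lemma full_monomialE1 (x : pos) : full_monomial n (enum_rank x) = 1%N.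
Proof.
rewrite /full_monomial pair_bigA pair_bigA /= mnm_sumE (bigD1 x) //=.
rewrite big1 => [|y ne_y]; rewrite mnm1E (inj_eq enum_rank_inj).
  by case: x => [[i j] k]; rewrite eqxx.
by case: y ne_y => [[i j] k] /negPf ->.
Qed.

(** The exponent of the variable at [x] in the monomial of [F] is the number of
    symbols whose diagonal passes through [x]. *)
Lemma family_monomial_full F : (family_monomial F == full_monomial n) = tiling F.
Proof.
have FE x : family_monomial F (enum_rank x) = #|[set s | x \in diagonal (F s)]|.
  rewrite mnm_sumE -sum1dep_card [RHS]big_mkcond /=.
  by apply: eq_bigr => s _; rewrite diagonal_monomialE; case: (x \in _).
apply/eqP/forallP => [eqF x | Ft].
  by rewrite -FE eqF full_monomialE1.
apply/mnmP => v; rewrite -(enum_valK v) FE full_monomialE1.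
exact/eqP/Ft.
Qed.

Lemma mcoeff_hyperdet_exp :
  (hyperdet (@generic_array n) ^+ (n ^ 2))@_(full_monomial n) =
  \sum_(F : family | tiling F) \prod_s perm_pair_sign (F s).
Proof.
rewrite hyperdet_exp_expansion raddf_sum /= [RHS]big_mkcond /=.
apply: eq_bigr => F _; rewrite mcoeffZ mcoeffX family_monomial_full.
by case: (tiling F); rewrite ?mulr1 ?mulr0.
Qed.

End LatinCubes.

Theorem theorem5p3 (n : nat) (n_ge1 : (1 <= n)%N) :
  (num_symbol_even n)%:Z - (num_symbol_odd n)%:Z =
  (hyperdet (@generic_array n) ^+ (n ^ 2))@_(full_monomial n).
Proof.
have n2_gt0 : (0 < n ^ 2)%N by rewrite expn_gt0 n_ge1.
by rewrite mcoeff_hyperdet_exp (sum_tiling_latin (Ordinal n2_gt0)) sum_symbol_sign.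
Qed.
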